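(* Let $\rho(a,b)\subset\mathbb{R}^3$ be a unit rhombus with diagonals $a,b>0$. Suppose $\rho(a,b)$ can be domed. Then there is a nonzero polynomial $P\in\mathbb{Q}[x,y]$ such that $P(a^2,b^2)=0$.
   Context: A unit rhombus is a closed polygon $[v_1v_2v_3v_4]$ in $\mathbb{R}^3$ with $|v_1v_2|=|v_2v_3|=|v_3v_4|=|v_4v_1|=1$; its diagonals are $a=|v_1v_3|$ and $b=|v_2v_4|$, and $\rho(a,b)$ denotes the unit rhombus with these diagonals (determined up to rigid motion; necessarily $a^2+b^2\le 4$). A closed polygon with unit edges $\gamma=[v_1\dots v_n]$ can be domed if there is a dome over it: a finite connected 2-dimensional simplicial complex $\Sigma$ which is a compact surface (orientable or not, any genus) whose boundary is a single cycle, together with a map $f:\Sigma\to\mathbb{R}^3$ that is linear on each simplex, sends every triangle to an equilateral triangle of side length $1$, and sends the boundary cycle of $\Sigma$ onto $\gamma$, vertex by vertex in cyclic order. No embedding or immersion condition is imposed. *)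

(* Defs.v *)
From HB Require Import structures.
From mathcomp Require Import all_boot all_order all_algebra.
From mathcomp Require Import reals.
Set Implicit Arguments. Unset Strict Implicit. Unset Printing Implicit Defensive.
Import Order.TTheory GRing.Theory Num.Theory.
Local Open Scope ring_scope.

Definition dist2 (R : realType) (p q : 'rV[R]_3) : R :=
  \sum_(i < 3) (p ord0 i - q ord0 i) ^+ 2.
Definition dist (R : realType) (p q : 'rV[R]_3) : R := Num.sqrt (dist2 p q).

(* A finite 2-dimensional simplicial complex on vertex set 'I_N is given by its
   set T of triangles (3-element vertex sets); the edges and vertices are the
   faces of the triangles (the complex is pure, as a surface must be). *)
Definition is_edge (N : nat) (T : {set {set 'I_N}}) (e : {set 'I_N}) : bool :=
  (#|e| == 2)%N && [exists t in T, e \subset t].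

Definition edge_degree (N : nat) (T : {set {set 'I_N}}) (e : {set 'I_N}) : nat :=
  #|[set t in T | e \subset t]|.

Definition is_boundary_edge (N : nat) (T : {set {set 'I_N}}) (e : {set 'I_N}) : bool :=
  is_edge T e && (edge_degree T e == 1)%N.

Definition adj (N : nat) (T : {set {set 'I_N}}) : rel 'I_N :=
  fun u w => [exists t in T, (u \in t) && (w \in t)].

Definition link_rel (N : nat) (T : {set {set 'I_N}}) (v : 'I_N) : rel 'I_N :=
  fun u w => [set v; u; w] \in T.

(* Sigma is a connected compact surface (with boundary, orientable or not):
   every triangle has 3 vertices, every vertex lies in a triangle, every edge lies
   in 1 or 2 triangles, the link of every vertex is connected (hence a path or a
   cycle, since all its degrees are 1 or 2), and Sigma is connected. *)
Definition is_surface (N : nat) (T : {set {set 'I_N}}) : Prop :=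
  [/\ forall t, t \in T -> #|t| = 3%N,
      forall v : 'I_N, exists2 t, t \in T & v \in t,
      forall e, is_edge T e -> (1 <= edge_degree T e <= 2)%N,
      forall v u w, is_edge T [set v; u] -> is_edge T [set v; w] ->
        connect (link_rel T v) u w
    & forall u w : 'I_N, connect (adj T) u w].

(* A closed polygon gamma = [gamma 0 ... gamma (n-1)] with unit edges can be
   domed: there is a dome (Sigma, f).  The map f, linear on simplices, is
   determined by the images of vertices; triangles go to unit equilateral
   triangles; the boundary of Sigma is a single cycle [w 0 ... w (n-1)] and
   f (w i) = gamma i. *)
Definition can_be_domed (R : realType) (n : nat) (gamma : 'I_n -> 'rV[R]_3) : Prop :=
  exists (N : nat) (T : {set {set 'I_N}}) (f : 'I_N -> 'rV[R]_3) (w : 'I_n -> 'I_N),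
    [/\ is_surface T,
        injective w,
        forall e, is_boundary_edge T e <-> exists i : 'I_n, e = [set w i; w (ordS i)],
        forall t u v, t \in T -> u \in t -> v \in t -> u != v -> dist (f u) (f v) = 1
      & forall i, f (w i) = gamma i].

Definition eval2 (R : realType) (P : {poly {poly rat}}) (x y : R) : R :=
  (map_poly (map_poly (@ratr R)) P).[y%:P].[x].

(* Main.v *)
Require Import Defs.
From HB Require Import structures.
From mathcomp Require Import all_boot all_order all_algebra.
From mathcomp Require Import boolp classical_sets reals ring.
Import Order.TTheory GRing.Theory Num.Theory.
Local Open Scope ring_scope.
Set Implicit Arguments. Unset Strict Implicit.

(* If [a^2] and [b^2] were algebraically independent over the rationals, some
   valuation ring [O] of the real field would contain neither of them. Call two
   vertices of the dome adjacent if their squared distance lies in [O]; the edges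
   of the dome are adjacent pairs, the diagonals of the rhombus are not.

   Among the vertices adjacent to a given vertex [o], choose [i], [j] such that
   the scalar product of [i - o] and [j - o] has least valuation. The vanishing of
   4x4 Gram determinants in dimension 3 shows that the neighbours of [i] in this
   set are pairwise adjacent. Hence the links of the adjacency graph are chordal,
   and their first cohomology mod 2 vanishes. Therefore a mod 2 cocycle on the
   subgraph spanned by the boundary of the rhombus, a 4-cycle without chords,
   extends vertex by vertex to the whole graph. Summing over all triangles of the
   dome shows that it vanishes on the boundary cycle, but the cocycle carried by
   one boundary edge does not. *)

(** * Reciprocal polynomials *)

Definition rev_poly (A : nzSemiRingType) (n : nat) (p : {poly A}) : {poly A} :=
  \poly_(i < n.+1) p`_(n - i).

Lemma rev_poly_eq0 (A : nzSemiRingType) n (p : {poly A}) :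
  (size p <= n.+1)%N -> rev_poly n p = 0 -> p = 0.
Proof.
move=> sp /polyP rp0; apply/polyP => i; rewrite coef0.
have [lt_in|le_ni] := ltnP i n.+1; last by rewrite nth_default ?(leq_trans sp).
have := rp0 (n - i)%N; rewrite coef_poly coef0 ltnS leq_subr.
by rewrite subKn // -ltnS.
Qed.

Lemma map_rev_poly (A B : nzSemiRingType) (f : {additive A -> B}) n
    (p : {poly A}) :
  map_poly f (rev_poly n p) = rev_poly n (map_poly f p).
Proof.
apply/polyP => i; rewrite coef_map [in LHS]coef_poly [in RHS]coef_poly.
by case: ifP => _; rewrite ?raddf0 ?coef_map.
Qed.

(** The hypothesis [x * x' = 1] replaces division, so that the formula applies in a field and also
    to constant polynomials, which is how the outer variable of a bivariate polynomial is
    inverted. *)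
Lemma horner_rev_poly (A : comNzSemiRingType) n (p : {poly A}) x x' :
  x * x' = 1 -> (size p <= n.+1)%N -> (rev_poly n p).[x] = x ^+ n * p.[x'].
Proof.
move=> xx' sp; rewrite horner_poly (horner_coef_wide _ sp) mulr_sumr.
rewrite (reindex_inj rev_ord_inj) /=; apply: eq_bigr => i _.
have le_in : (i <= n)%N by rewrite -ltnS.
rewrite subSS subKn // mulrCA; congr (_ * _).
have -> : x ^+ n = x ^+ (n - i) * x ^+ i by rewrite -exprD subnK.
by rewrite -mulrA -exprMn xx' expr1n mulr1.
Qed.

(** * Chevalley's theorem: valuation rings from maximal subrings *)

Section ValuationRing.
Local Open Scope classical_set_scope.
Variable F : fieldType.
Implicit Types (S : set F) (x y z u v : F) (p q : {poly F}).

Definition is_subring S : Prop :=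
  [/\ S 1, forall x y, S x -> S y -> S (x - y)
    & forall x y, S x -> S y -> S (x * y)].

Definition is_valuation_ring S : Prop :=
  is_subring S /\ forall x, S x \/ S x^-1.

Definition ideal2 u v S : set F :=
  [set x | exists s t, [/\ S s, S t & x = u * s + v * t]].

(** The set [S] is arbitrary: it will be a subring, or the ideal generated by [u] and [v] in it. *)
Definition coefs_in S : set {poly F} := [set p | forall i, S p`_i].

Section SubringTheory.
Variable S : set F.
Hypothesis ringS : is_subring S.

Lemma subring1 : S 1. Proof. by case: ringS. Qed.
Lemma subringB x y : S x -> S y -> S (x - y).
Proof. by case: ringS => _ + _; apply. Qed.
Lemma subringM x y : S x -> S y -> S (x * y).
Proof. by case: ringS => _ _; apply. Qed.
Lemma subring0 : S 0.
Proof. by rewrite -(subrr 1); apply: subringB; apply: subring1. Qed.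
Lemma subringN x : S x -> S (- x).
Proof. by rewrite -sub0r; apply: subringB; apply: subring0. Qed.
Lemma subringD x y : S x -> S y -> S (x + y).
Proof. by move=> Sx Sy; rewrite -[y]opprK; apply/subringB/subringN. Qed.
Lemma subringX x n : S x -> S (x ^+ n).
Proof.
move=> Sx; elim: n => [|n IHn]; first by rewrite expr0; apply: subring1.
by rewrite exprS; apply: subringM.
Qed.
Lemma subring_sum (I : finType) (G : I -> F) :
  (forall i, S (G i)) -> S (\sum_i G i).
Proof. by move=> SG; elim/big_ind: _ => //; [exact: subring0|exact: subringD]. Qed.

Lemma ideal2D u v x y : ideal2 u v S x -> ideal2 u v S y -> ideal2 u v S (x + y).
Proof.
move=> [s [t [Ss St ->]]] [s' [t' [Ss' St' ->]]].
by exists (s + s'), (t + t'); split; [exact: subringD..|ring].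
Qed.
Lemma ideal2M u v x y : ideal2 u v S x -> S y -> ideal2 u v S (x * y).
Proof.
move=> [s [t [Ss St ->]]] Sy.
by exists (s * y), (t * y); split; [exact: subringM..|ring].
Qed.
Lemma ideal20 u v : ideal2 u v S 0.
Proof. by exists 0, 0; split; [exact: subring0..|ring]. Qed.
Lemma ideal2_sub u v x : S u -> S v -> ideal2 u v S x -> S x.
Proof. by move=> Su Sv [s [t [Ss St ->]]]; apply: subringD; apply: subringM. Qed.
Lemma ideal2_sum u v (I : finType) (G : I -> F) :
  (forall i, ideal2 u v S (G i)) -> ideal2 u v S (\sum_i G i).
Proof. by move=> SG; elim/big_ind: _ => //; [exact: ideal20|exact: ideal2D]. Qed.

Definition adjoin z : set F := [set q.[z] | q in coefs_in S].

Lemma adjoin_subring z : is_subring (adjoin z).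
Proof.
split.
- exists 1; rewrite ?hornerC // => i; rewrite coef1.
  by case: eqP => _; [exact: subring1|exact: subring0].
- move=> _ _ [p Sp <-] [q Sq <-]; exists (p - q); rewrite ?hornerD ?hornerN //.
  by move=> i; rewrite coefB; apply: subringB.
- move=> _ _ [p Sp <-] [q Sq <-]; exists (p * q); rewrite ?hornerM //.
  by move=> i; rewrite coefM; apply: subring_sum => j; apply: subringM.
Qed.

Lemma sub_adjoin z x : S x -> adjoin z x.
Proof.
move=> Sx; exists x%:P; rewrite ?hornerC // => i; rewrite coefC.
by case: eqP => _ //; apply: subring0.
Qed.

Lemma mem_adjoin z : adjoin z z.
Proof.
exists 'X; rewrite ?hornerX // => i; rewrite coefX.
by case: eqP => _; [exact: subring1|exact: subring0].
Qed.

Lemma ideal2_adjoin u v z x : ideal2 u v (adjoin z) x ->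
  exists2 p, coefs_in (ideal2 u v S) p & p.[z] = x.
Proof.
move=> [_ [_ [[p Sp <-] [q Sq <-] ->]]].
exists (u *: p + v *: q); last by rewrite hornerD !hornerZ.
by move=> i; exists p`_i, q`_i; split=> //; rewrite coefD !coefZ.
Qed.

(** Modulo the ideal [1 - x] equals 1, hence so do its powers. *)
Lemma ideal2_exp1B u v x n : S u -> S v -> ideal2 u v S x ->
  ideal2 u v S (1 - (1 - x) ^+ n).
Proof.
move=> Su Sv mx; have Sx := ideal2_sub Su Sv mx.
elim: n => [|n IHn]; first by rewrite expr0 subrr; apply: ideal20.
have -> : 1 - (1 - x) ^+ n.+1 = (1 - (1 - x) ^+ n) * (1 - x) + x.
  by rewrite exprSr; ring.
apply: ideal2D => //; apply: ideal2M => //.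
by apply: subringB => //; apply: subring1.
Qed.

End SubringTheory.

Section MaximalSubring.
Variables (u v : F) (S : set F).
Hypotheses (ringS : is_subring S) (Su : S u) (Sv : S v).
Hypothesis proper : ~ ideal2 u v S 1.
Hypothesis maxS : forall z, ~ S z -> ideal2 u v (adjoin S z) 1.

(** Otherwise maximality writes 1 as a polynomial in [(1 - x)^-1] with coefficients in the ideal.
    Clearing denominators puts a power of [1 - x] into the ideal; this power is congruent to 1, so
    the ideal would not be proper. *)
Lemma unit_1B_ideal2 x : ideal2 u v S x -> S (1 - x)^-1.
Proof.
move=> mx; apply: contrapT => /maxS /ideal2_adjoin.
case=> p mp pz1; have Sx := ideal2_sub ringS Su Sv mx.
have c0 : 1 - x != 0 by apply/eqP => /subr0_eq x1; apply: proper; rewrite x1.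
have Sc : S (1 - x) by apply: subringB => //; apply: subring1.
have mc : ideal2 u v S ((1 - x) ^+ size p).
  have <- : (rev_poly (size p) p).[1 - x] = (1 - x) ^+ size p.
    by rewrite (@horner_rev_poly F _ _ _ (1 - x)^-1) ?divff // pz1 mulr1.
  rewrite horner_poly; apply: ideal2_sum => // i; apply: ideal2M => //.
  exact: subringX.
apply: proper; rewrite -(subrK ((1 - x) ^+ size p) 1).
by apply: ideal2D => //; apply: ideal2_exp1B.
Qed.

(** Descent on the sum of the sizes: the relation of smaller degree expresses a power of [z], or of
    its inverse, by lower powers, and substituting this lowers the degree of the other relation. *)
Lemma no_double_relation z n p q : z != 0 -> (size p + size q <= n)%N ->
  coefs_in (ideal2 u v S) p -> coefs_in (ideal2 u v S) q ->
  p.[z] = 1 -> q.[z^-1] = 1 -> False.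
Proof.
elim: n z p q => [|n IHn] z p q z0 spq mp mq pz qz.
  have := leq_trans (leq_addr _ _) spq; rewrite size_poly_leq0 => /eqP p0.
  by move: pz; rewrite p0 horner0 => /eqP; rewrite eq_sym oner_eq0.
(* Exchanging [z] with its inverse exchanges [p] and [q]. *)
wlog leqp : z p q z0 spq mp mq pz qz / (size q <= size p)%N.
  move=> W; have [|/ltnW] := leqP (size q) (size p); first exact: (W z p q).
  by apply: (W z^-1 q p); rewrite ?invr_eq0 ?invrK // addnC.
have sq1 : (1 < size q)%N.
  rewrite ltnNge; apply/negP => /size1_polyC qC; apply: proper.
  by rewrite -qz qC hornerC.
case sqE : (size q) sq1 leqp => [//|d] d_gt0 leqp.
set c := 1 - q`_0; have Sc : S c^-1 by apply: unit_1B_ideal2.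
have c0 : c != 0.
  by apply/eqP => /subr0_eq q1; apply: proper; rewrite q1.
pose r := c^-1 *: take_poly d (rev_poly d q).
have mr : coefs_in (ideal2 u v S) r.
  move=> i; rewrite coefZ mulrC; apply: ideal2M => //.
  rewrite coef_take_poly coef_poly.
  by case: ifP => // _; [case: ifP => // _|]; apply: ideal20.
have zd : z ^+ d = r.[z].
  have : z ^+ d = (rev_poly d q).[z] 
    by rewrite (@horner_rev_poly F _ _ _ z^-1) ?divff ?sqE // qz mulr1.
  rewrite -[rev_poly d q in X in X -> _](poly_take_drop d) hornerD hornerM hornerXn.
  have -> : drop_poly d (rev_poly d q) = (q`_0)%:P.
    apply/polyP => i; rewrite coef_drop_poly coef_poly coefC.
    by case: i => [|i]; rewrite ?add0n ?ltnSn ?subnn // ltnS addSn ltnNge leq_addl.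
  rewrite hornerC hornerZ => e; apply: (mulfI c0); rewrite mulVKf //.
  by rewrite /c mulrBl mul1r {1}e addrK.
case spE : (size p) leqp spq => [//|e] led; rewrite sqE => spq.
(* The top power [z ^+ e] of [p] is replaced by [z ^+ (e - d) * r.[z]]. *)
pose p' := take_poly e p + lead_coef p *: ('X^(e - d) * r).
have sp' : (size p' <= e)%N.
  apply: (leq_trans (size_polyD _ _)); rewrite geq_max size_take_poly /=.
  apply: (leq_trans (size_scale_leq _ _)); apply: (leq_trans (size_polyMleq _ _)).
  rewrite size_polyXn addSn /= -leq_subRL ?leq_subr // subKn //.
  exact: (leq_trans (size_scale_leq _ _) (size_take_poly _ _)).
apply: (IHn z p' q) => //.
- by rewrite sqE -ltnS; apply: leq_trans spq; rewrite addSn ltnS leq_add2r.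
- move=> i; rewrite coefD coef_take_poly coefZ; apply: ideal2D => //.
    by case: ifP => // _; apply: ideal20.
  apply: ideal2M => //; first exact: mp.
  rewrite coefXnM; case: ifP => // _; first exact: subring0.
  exact: (ideal2_sub ringS Su Sv (mr _)).
- rewrite hornerD hornerZ hornerM hornerXn -zd -exprD subnK // -[RHS]pz.
  rewrite -{3}[p](poly_take_drop e) hornerD hornerM hornerXn.
  have -> : drop_poly e p = (lead_coef p)%:P.
    apply/polyP => i; rewrite coef_drop_poly coefC lead_coefE spE.
    by case: i => [|i] //=; rewrite nth_default // spE addSn ltnS leq_addl.
  by rewrite hornerC.
Qed.

Lemma maximal_subring_valuation : is_valuation_ring S.
Proof.
split=> // z; have [->|z0] := eqVneq z 0; first by left; apply: subring0.
apply: contrapT => /not_orP[/maxS/ideal2_adjoin[p mp pz]].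
move=> /maxS/ideal2_adjoin[q mq qz].
exact: (no_double_relation z0 (leqnn _) mp mq pz qz).
Qed.

End MaximalSubring.

(** Zorn's lemma yields a subring maximal among those that contain [S] and in which [u] and [v]
    generate a proper ideal; such a ring is a valuation ring. *)
Lemma exists_valuation_ring u v S : is_subring S -> S u -> S v ->
  ~ ideal2 u v S 1 ->
  exists O, [/\ is_valuation_ring O, S `<=` O & ~ ideal2 u v O 1].
Proof.
move=> ringS Su Sv prS.
pose good O := [/\ is_subring O, S `<=` O & ~ ideal2 u v O 1].
have [C sCP totC|O [PO maxO]] := @Zorn_bigcup F [set O | O = set0 \/ good O].
  have goodC X x : C X -> X x -> good X.
    by move=> CX Xx; case: (sCP X CX) => // X0; rewrite X0 in Xx.
  have chain2 X Y x y : C X -> C Y -> X x -> Y y ->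
      exists Z, [/\ C Z, good Z, Z x & Z y].
    move=> CX CY Xx Yy; case: (totC X Y CX CY) => [XY|YX].
      by exists Y; split=> //; [exact: goodC Yy|exact: XY].
    by exists X; split=> //; [exact: goodC Xx|exact: YX].
  have [[X CX [x0 Xx0]]|noX] := pselect (exists2 X, C X & X !=set0); last first.
    left; rewrite -subset0 => x [X CX Xx]; case: noX.
    by exists X => //; exists x.
  have [rX sSX prX] := goodC _ _ CX Xx0.
  right; split.
  - split; first by exists X => //; case: rX.
    + move=> x y [Y CY Yx] [Z CZ Zy].
      have [W [CW [rW _ _] Wx Wy]] := chain2 _ _ _ _ CY CZ Yx Zy.
      by exists W => //; apply: subringB.
    + move=> x y [Y CY Yx] [Z CZ Zy].
      have [W [CW [rW _ _] Wx Wy]] := chain2 _ _ _ _ CY CZ Yx Zy.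
      by exists W => //; apply: subringM.
  - by move=> x Sx; exists X => //; apply: sSX.
  - move=> [s [t [[Y CY Ys] [Z CZ Zt] e]]].
    have [W [CW [rW _ prW] Ws Wt]] := chain2 _ _ _ _ CY CZ Ys Zt.
    by apply: prW; exists s, t.
have goodO : good O.
  case: PO => // O0; exfalso; apply: (maxO S); last by right; split.
  rewrite O0; split=> // sS0; exact: (sS0 1 (subring1 ringS)).
have [rO sSO prO] := goodO.
exists O; split=> //; apply: (@maximal_subring_valuation u v) => //.
- exact: sSO.
- exact: sSO.
- move=> z nOz; apply: contrapT => prz; apply: (maxO (adjoin O z)).
    split; first by move=> x; apply: sub_adjoin.
    by move=> sAO; apply: nOz; apply: sAO; apply: mem_adjoin.
  right; split=> //; first exact: adjoin_subring.
  by move=> x /sSO; apply: sub_adjoin.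
Qed.

(** Inverses of elements outside [O] lie in its maximal ideal. Concretely, by symmetry [x / y] may
    be taken in [O]; multiplying the relation by [x] would then put [x] in [O]. *)
Lemma valuation_ring_infinitesimal O x y r s : is_valuation_ring O ->
  ~ O x -> ~ O y -> O r -> O s -> x^-1 * r + y^-1 * s <> 1.
Proof.
move=> [ringO valO].
have neq0 z : ~ O z -> z != 0.
  by move=> nOz; apply/eqP => z0; apply: nOz; rewrite z0; apply: subring0.
wlog Oxy : x y r s / O (x / y).
  move=> W nOx nOy Or Os; case: (valO (x / y)) => [|]; first by move=> /W; apply.
  by rewrite invf_div addrC => /W; apply.
move=> nOx nOy Or Os e; have x0 := neq0 _ nOx; have y0 := neq0 _ nOy.
apply: nOx.
have -> : x = r + x / y * s.
  rewrite -[LHS]mulr1 -e; field.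
  by rewrite x0 y0.
by apply: subringD => //; apply: subringM.
Qed.

End ValuationRing.

(** * Algebraic independence and a valuation ring at infinity *)

Section BivariateEvaluation.
Variable R : realType.
Implicit Types (P Q : {poly {poly rat}}) (x y : R).

Lemma eval2B P Q x y : eval2 (P - Q) x y = eval2 P x y - eval2 Q x y.
Proof. by rewrite /eval2 rmorphB !(hornerD, hornerN). Qed.

Lemma eval2M P Q x y : eval2 (P * Q) x y = eval2 P x y * eval2 Q x y.
Proof. by rewrite /eval2 rmorphM !hornerM. Qed.

Lemma eval2_1 x y : eval2 1 x y = 1.
Proof. by rewrite /eval2 rmorph1 !hornerC. Qed.

Lemma eval2X x y : eval2 'X x y = y.
Proof. by rewrite /eval2 map_polyX hornerX hornerC. Qed.

Lemma eval2_CX x y : eval2 'X%:P x y = x.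
Proof. by rewrite /eval2 map_polyC hornerC /= map_polyX hornerX. Qed.

Lemma eval2E P x y n : (size P <= n)%N ->
  eval2 P x y = \sum_(j < n) (map_poly ratr P`_j).[x] * y ^+ j.
Proof.
move=> sP; rewrite /eval2 (@horner_coef_wide {poly R} n) /=; last first.
  exact: leq_trans (size_poly _ _) sP.
rewrite horner_sum; apply: eq_bigr => j _.
by rewrite hornerM horner_exp hornerC coef_map.
Qed.

(** The polynomial [P] is reversed in each variable in turn: first in the inner one, coefficient by
    coefficient, then in the outer one. *)
Lemma eval2_eq0_inv P x y : x != 0 -> y != 0 -> P != 0 -> eval2 P x y = 0 ->
  exists Q, Q != 0 /\ eval2 Q x^-1 y^-1 = 0.
Proof.
move=> x0 y0 P0 Pxy.
(* All coefficients are reversed with the same bound, so that the common factor [x^-1 ^+ n] comes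
   out of the sum. *)
pose n := (\max_(j < size P) size (P`_j)%R)%N.
have sPj j : (size (P`_j)%R <= n.+1)%N.
  have [lt_j|le_j] := ltnP j (size P); last by rewrite nth_default ?size_poly0.
  by apply: leqW; apply: (leq_bigmax (Ordinal lt_j)).
have rev0 : rev_poly n (0 : {poly rat}) = 0.
  by apply/polyP => i; rewrite coef_poly !coef0 if_same.
pose P1 := map_poly (rev_poly n) P.
have sP1 : (size P1 <= size P)%N by apply: size_poly.
have P1j j : P1`_j = rev_poly n P`_j by rewrite coef_map_id0.
have P1_0 : P1 != 0.
  apply: contra_neq P0 => P1_0; apply/polyP => j; rewrite coef0.
  by apply: (rev_poly_eq0 (sPj j)); rewrite -P1j P1_0 coef0.
have eP1 : eval2 P1 x^-1 y = 0.
  suff -> : eval2 P1 x^-1 y = x^-1 ^+ n * eval2 P x y by rewrite Pxy mulr0.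
  rewrite (eval2E _ _ sP1) (eval2E _ _ (leqnn _)) mulr_sumr.
  apply: eq_bigr => j _.
  rewrite P1j map_rev_poly (@horner_rev_poly _ _ _ _ x) ?mulVf ?mulrA //.
  exact: leq_trans (size_poly _ _) (sPj j).
exists (rev_poly (size P1) P1); split.
  by apply: contra_neq P1_0; apply: rev_poly_eq0.
rewrite /eval2 map_rev_poly (@horner_rev_poly _ _ _ _ y%:P).
- by rewrite hornerM -[X in _ * X]/(eval2 P1 x^-1 y) eP1 mulr0.
- by rewrite -polyCM mulVf.
- exact: leqW (size_poly _ _).
Qed.

Local Open Scope classical_set_scope.

(** Chevalley's theorem is applied to the ring generated over the rationals by [x^-1] and [y^-1].
    These generate a proper ideal, and remain non-units in [O], so [O] omits [x] and [y]. *)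
Lemma exists_valuation_ring_at_infinity x y : x != 0 -> y != 0 ->
  ~ (exists P, P != 0 /\ eval2 P x y = 0) ->
  exists O : set R, [/\ is_valuation_ring O, ~ O x & ~ O y].
Proof.
move=> x0 y0 indep.
pose S := range (fun P => eval2 P x^-1 y^-1).
have [|||[_ [_ [[P _ <-] [Q _ <-] e]]]|O [vO SO prO]] :=
    @exists_valuation_ring R x^-1 y^-1 S.
- split; first by exists 1; rewrite ?eval2_1.
  + by move=> _ _ [P _ <-] [Q _ <-]; exists (P - Q); rewrite ?eval2B.
  + by move=> _ _ [P _ <-] [Q _ <-]; exists (P * Q); rewrite ?eval2M.
- by exists 'X%:P; rewrite ?eval2_CX.
- by exists 'X; rewrite ?eval2X.
(* If 1 were in the ideal, the inverses would be a zero of a polynomial with constant term 1, hence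
   nonzero; passing to reciprocals contradicts independence. *)
- apply: indep; rewrite -[x]invrK -[y]invrK.
  apply: (@eval2_eq0_inv (1 - 'X%:P * P - 'X * Q)); rewrite ?invr_eq0 //.
    apply/eqP => /polyP/(_ 0%N)/polyP/(_ 0%N)/eqP.
    by rewrite !(coefB, coefCM, coefXM, coef1, coef0) /= !subr0 oner_eq0.
  by rewrite !eval2B eval2_1 !eval2M eval2_CX eval2X e; ring.
have [rO _] := vO.
exists O; split=> // [Ox|Oy]; apply: prO.
  by exists x, 0; rewrite mulVf // mulr0 addr0; split=> //; apply: subring0.
by exists 0, y; rewrite mulVf // mulr0 add0r; split=> //; apply: subring0.
Qed.

End BivariateEvaluation.

(** * Comparison of valuations by divisibility *)

Section ValuationDivisibility.
Local Open Scope classical_set_scope.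
Variables (F : fieldType) (O : set F).
Hypothesis vO : is_valuation_ring O.

(** This says that the valuation of [x] is at least that of [y], without constructing the value
    group. *)
Definition dvd_in (y x : F) : Prop := exists2 c, O c & x = c * y.

Lemma dvd_in_refl x : dvd_in x x.
Proof. by exists 1; rewrite ?mul1r //; apply: (subring1 vO.1). Qed.

Lemma dvd_in_trans x y z : dvd_in x y -> dvd_in y z -> dvd_in x z.
Proof.
move=> [c Oc ->] [d Od ->].
by exists (d * c); rewrite ?mulrA //; apply: (subringM vO.1).
Qed.

Lemma dvd_in_total x y : dvd_in y x \/ dvd_in x y.
Proof.
have O0 := subring0 vO.1.
have [->|x0] := eqVneq x 0; first by left; exists 0; rewrite ?mul0r.
have [->|y0] := eqVneq y 0; first by right; exists 0; rewrite ?mul0r.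
case: (vO.2 (x / y)) => [Oxy|]; first by left; exists (x / y); rewrite ?divfK.
by rewrite invf_div => Oyx; right; exists (y / x); rewrite ?divfK.
Qed.

Lemma exists_dvd_in_min (s : seq F) : s != [::] ->
  exists2 m, m \in s & forall x, x \in s -> dvd_in m x.
Proof.
elim: s => // x s IHs _; have [->|s0] := eqVneq s [::].
  by exists x; rewrite ?mem_head // => y; rewrite inE => /eqP->; apply: dvd_in_refl.
have [m ms mP] := IHs s0; case: (dvd_in_total x m) => [mx|xm].
  by exists m => [|y]; rewrite inE ?ms ?orbT // => /predU1P[->|/mP].
exists x => [|y]; first exact: mem_head.
rewrite inE => /predU1P[->|/mP]; first exact: dvd_in_refl.
exact: dvd_in_trans.
Qed.

End ValuationDivisibility.

(** * Gram determinants and the links of the finite-distance graph *)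

Section LinkGeometry.
Local Open Scope classical_set_scope.
Variable R : realType.
Implicit Types o p q : 'rV[R]_3.

Lemma dist2C p q : dist2 p q = dist2 q p.
Proof. by apply: eq_bigr => i _; rewrite -opprB sqrrN. Qed.

Lemma dist_eq_sqr p q d : dist p q = d -> dist2 p q = d ^+ 2.
Proof. by move=> <-; rewrite sqr_sqrtr // sumr_ge0 // => i _; rewrite sqr_ge0. Qed.

(* Twice the scalar product of [p - o] and [q - o]. *)
Definition gram o p q : R := dist2 p o + dist2 q o - dist2 p q.

Lemma gramE o p q : gram o p q =
  2 * \sum_(i < 3) (p ord0 i - o ord0 i) * (q ord0 i - o ord0 i).
Proof.
rewrite /gram /dist2 -!sumrN -!big_split mulr_sumr /=.
by apply: eq_bigr => i _; ring.
Qed.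

(** The left side is the expanded determinant of the symmetric 4x4 matrix of the [g pi pj]. It
    vanishes because four vectors in dimension 3 are dependent. *)
Lemma gram_det4 o p1 p2 p3 p4 (g := gram o) :
  g p1 p1 * g p2 p2 * g p3 p3 * g p4 p4
  - (g p1 p2 ^+ 2 * g p3 p3 * g p4 p4 + g p1 p3 ^+ 2 * g p2 p2 * g p4 p4
   + g p1 p4 ^+ 2 * g p2 p2 * g p3 p3 + g p2 p3 ^+ 2 * g p1 p1 * g p4 p4
   + g p2 p4 ^+ 2 * g p1 p1 * g p3 p3 + g p3 p4 ^+ 2 * g p1 p1 * g p2 p2)
  + (g p1 p2 ^+ 2 * g p3 p4 ^+ 2 + g p1 p3 ^+ 2 * g p2 p4 ^+ 2
   + g p1 p4 ^+ 2 * g p2 p3 ^+ 2)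
  + 2 * (g p1 p2 * g p2 p3 * g p1 p3 * g p4 p4
       + g p1 p2 * g p2 p4 * g p1 p4 * g p3 p3
       + g p1 p3 * g p3 p4 * g p1 p4 * g p2 p2
       + g p2 p3 * g p3 p4 * g p2 p4 * g p1 p1)
  - 2 * (g p1 p2 * g p2 p3 * g p3 p4 * g p1 p4
       + g p1 p2 * g p2 p4 * g p3 p4 * g p1 p3
       + g p1 p3 * g p2 p3 * g p2 p4 * g p1 p4) = 0.
Proof.
rewrite /g !gramE !big_ord_recl !big_ord0.
(* Abstracting the coordinates of the four difference vectors leaves a polynomial identity in twelve
   variables. *)
do 3! [set x := (p1 ord0 _ - _); move: x => ?].
do 3! [set x := (p2 ord0 _ - _); move: x => ?].
do 3! [set x := (p3 ord0 _ - _); move: x => ?].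
do 3! [set x := (p4 ord0 _ - _); move: x => ?].
ring.
Qed.

Variable O : set R.
Hypothesis vO : is_valuation_ring O.

(* Dividing the vanishing Gram determinant by [g p1 p2 ^+ 2 * g p3 p4 ^+ 2]
   would write 1 as a sum of two infinitesimals. *)
Lemma gram_finite o p1 p2 p3 p4 (g := gram o) :
  (forall p, p \in [:: p1; p2; p3; p4] -> O (g p p)) ->
  ~ O (g p1 p2) -> dvd_in O (g p1 p2) (g p1 p3) -> dvd_in O (g p1 p2) (g p1 p4) ->
  O (g p2 p3) -> O (g p2 p4) -> O (g p3 p4).
Proof.
move=> Og nO12 [x Ox e13] [y Oy e14] O23 O24; apply: contrapT => nO34.
have O11 : O (g p1 p1) by apply: Og; rewrite !inE eqxx ?orbT.
have O22 : O (g p2 p2) by apply: Og; rewrite !inE eqxx ?orbT.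
have O33 : O (g p3 p3) by apply: Og; rewrite !inE eqxx ?orbT.
have O44 : O (g p4 p4) by apply: Og; rewrite !inE eqxx ?orbT.
have [rO valO] := vO.
have inv_in z : ~ O z -> z != 0 /\ O z^-1.
  move=> nOz; split; last by case: (valO z).
  by apply/eqP => z0; apply: nOz; rewrite z0; apply: subring0.
have [M0 Ou] := inv_in _ nO12; have [A0 Ow] := inv_in _ nO34.
have := gram_det4 o p1 p2 p3 p4; cbv zeta; rewrite -/g e13 e14.
move: M0 A0 Ou Ow O11 O22 O33 O44 O23 O24 nO12 nO34.
move: (g p1 p1) (g p2 p2) (g p3 p3) (g p4 p4) (g p2 p3) (g p2 p4).
move: (g p1 p2) (g p3 p4) => M A g11 g22 g33 g44 a b.
move=> M0 A0 Ou Ow O11 O22 O33 O44 O23 O24 nOM nOA det0.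
set u := M^-1 in Ou; set w := A^-1 in Ow.
(* After division by [M ^+ 2 * A ^+ 2] the determinant reads [1 - u * (u * g11 * g22) - w * s]:
   apart from the leading 1, only the term with [A ^+ 2] and [g11 * g22] lacks a factor [w]. Writing
   [1 + 1] for 2 lets closure under addition prove membership in [O]. *)
pose s := w * (- (u * u * g11 * g22 * g33 * g44)
    + (g33 * g44 + x * x * g22 * g44 + y * y * g22 * g33
       + u * u * (a * a * g11 * g44 + b * b * g11 * g33))
    - (x * x * b * b + y * y * a * a)
    - (1 + 1) * (a * x * g44 + b * y * g33 - x * y * a * b))
    - (1 + 1) * (x * y * g22 + u * u * a * b * g11 - a * y - b * x).
have O1 := subring1 rO.
apply: (@valuation_ring_infinitesimal R O M A (u * g11 * g22) s) => //.
- by do ?apply: (subringM rO).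
- rewrite /s.
  by repeat first [assumption | apply: (subringD rO) | apply: (subringN rO)
    | apply: (subringM rO)].
apply: (mulfI (_ : M ^+ 2 * A ^+ 2 != 0)); first by rewrite mulf_neq0 ?expf_neq0.
rewrite mulr1 -[RHS]subr0 -det0 /s /u /w; field.
by rewrite M0 A0.
Qed.

(** Since [S] is any nonempty set of neighbours of [o], repeated use gives a perfect elimination
    order of the link, that is, chordality. *)
Lemma link_simplicial_vertex (V : finType) (f : V -> 'rV[R]_3) o (S : {set V}) :
  S != finset.set0 -> (forall k, k \in S -> O (dist2 (f k) o)) ->
  exists2 i, i \in S & forall k l, k \in S -> l \in S ->
    O (dist2 (f i) (f k)) -> O (dist2 (f i) (f l)) -> O (dist2 (f k) (f l)).
Proof.
move=> /set0Pn[i0 Si0] OS; have rO := vO.1.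
have finE k l : k \in S -> l \in S ->
    O (gram o (f k) (f l)) <-> O (dist2 (f k) (f l)).
  move=> /OS Ok /OS Ol; split=> Okl.
    have -> : dist2 (f k) (f l) =
        dist2 (f k) o + dist2 (f l) o - gram o (f k) (f l) by rewrite /gram; ring.
    by apply: (subringB rO) => //; apply: (subringD rO).
  by apply: (subringB rO) => //; apply: (subringD rO).
have Odiag k : k \in S -> O (gram o (f k) (f k)).
  move=> Sk; apply/(finE _ _ Sk Sk); rewrite /dist2 big1; first exact: subring0.
  by move=> i _; rewrite subrr expr0n.
pose s := [seq gram o (f kl.1) (f kl.2) | kl in finset.setX S S].
have [|m /mapP[[j i]]] := @exists_dvd_in_min _ _ vO s.
  rewrite -size_eq0 size_map -cardE cardsX muln_eq0 orbb cards_eq0.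
  by apply/set0Pn; exists i0.
rewrite mem_enum inE /= => /andP[Sj Si] -> ijP.
have {}ijP k l : k \in S -> l \in S ->
    dvd_in O (gram o (f j) (f i)) (gram o (f k) (f l)).
  move=> Sk Sl; apply: ijP; apply/mapP; exists (k, l) => //.
  by rewrite mem_enum inE Sk Sl.
exists i => // k l Sk Sl /(finE _ _ Si Sk) Oik /(finE _ _ Si Sl) Oil.
apply/(finE _ _ Sk Sl).
(* If even the product of least valuation is in [O], then all are and [S] is a clique. Otherwise the
   Gram determinant of [j], [i], [k], [l] decides. *)
have [Oij|nOij] := pselect (O (gram o (f j) (f i))).
  by have [c Oc ->] := ijP k l Sk Sl; apply: (subringM rO).
apply: (gram_finite _ nOij (ijP _ _ Sj Sk) (ijP _ _ Sj Sl) Oik Oil).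
by move=> p; rewrite !inE => /or4P[] /eqP->; apply: Odiag.
Qed.

End LinkGeometry.

(** * Mod 2 cocycles on graphs with chordal links *)

Section Cocycles.
Variables (V : finType) (adjc : rel V).
Hypothesis adjcC : symmetric adjc.
Implicit Types (S U : {set V}) (phi : V -> V -> bool).

(** These are the 1-cocycles of the clique complex of the graph induced on [U]. Only triples of
    distinct vertices count, so a reflexive [adjc] is harmless and the diagonal values of [phi] are
    free. *)
Definition cocycle_on U phi : Prop :=
  forall i j k, i \in U -> j \in U -> k \in U -> i != j -> j != k -> i != k ->
    adjc i j -> adjc j k -> adjc i k -> phi i k = phi i j (+) phi j k.

Definition simplicial_in S i : Prop :=
  forall k l, k \in S -> l \in S -> adjc i k -> adjc i l -> adjc k l.

(** Induction removes a simplicial vertex [i]. One neighbour of [i] fixes the potential at [i];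
    every other neighbour agrees, because the two neighbours and [i] form a triangle. *)
Lemma cocycle_on_coboundary S phi : (forall i j, phi i j = phi j i) ->
  (forall S', S' \subset S -> S' != finset.set0 ->
     exists2 i, i \in S' & simplicial_in S' i) ->
  cocycle_on S phi ->
  exists h : V -> bool, forall k l, k \in S -> l \in S -> k != l -> adjc k l ->
    phi k l = h k (+) h l.
Proof.
move=> phiC; have [n] := ubnP #|S|; elim: n S => // n IHn S leSn simS cocS.
have [->|S0] := eqVneq S finset.set0.
  by exists (fun=> false) => k l; rewrite inE.
have [i Si simi] := simS S (subxx _) S0.
have sSi : S :\ i \subset S by apply: subsetDl.
have [|S' sS'||h hP] := IHn (S :\ i).
- by move: leSn; rewrite (cardsD1 i S) Si.
- by apply: simS; apply: fintype.subset_trans sS' sSi.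
- by move=> a b c /setD1P[_ Sa] /setD1P[_ Sb] /setD1P[_ Sc]; apply: cocS.
(* Without a neighbour in [S :\ i] there is no condition at [i], and any value will do. *)
pose hi := if [pick k in S :\ i | adjc i k] is Some k
  then h k (+) phi i k else false.
exists (fun x => if x == i then hi else h x).
have hiP l : l \in S -> l != i -> adjc i l -> phi i l = hi (+) h l.
  move=> Sl li il; rewrite /hi; case: pickP => [k|/(_ l)]; last first.
    by rewrite !inE li Sl il.
  rewrite !inE => /andP[/andP[ki Sk] ik].
  have [->|lk] := eqVneq l k; first by rewrite addbC addKb.
  have kl : adjc k l by apply: simi.
  have [ik' il' kl'] : [/\ i != k, i != l & k != l] by rewrite !(eq_sym _ l) eq_sym.
  rewrite (cocS i k l) // (hP k l) ?inE ?ki ?li //.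
  by rewrite addbA [phi i k (+) _]addbC.
move=> k l Sk Sl kl; have [ki|ki] := eqVneq k i.
  by move: kl; rewrite ki eq_sym => li il; rewrite (negPf li); apply: hiP.
have [li|li] := eqVneq l i => adj_kl.
  by rewrite phiC li addbC; apply: hiP => //; rewrite adjcC -li.
by apply: hP; rewrite ?inE ?ki ?li.
Qed.

(** On the link of [p] the cocycle is the coboundary of some [h]. Taking [h k] as the value on the
    new edge from [p] to [k] makes this equation the cocycle condition on the triangles at [p]. *)
Lemma cocycle_on_extend U p phi : (forall i j, phi i j = phi j i) ->
  (forall S, (forall k, k \in S -> adjc p k) -> S != finset.set0 ->
     exists2 i, i \in S & simplicial_in S i) ->
  cocycle_on U phi ->
  exists phi', [/\ forall i j, phi' i j = phi' j i, cocycle_on (p |: U) phi'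
    & forall i j, i \in U -> j \in U -> phi' i j = phi i j].
Proof.
move=> phiC simp cocU; have [pU|pU] := boolP (p \in U).
  exists phi; split=> //.
  by have -> : p |: U = U by apply/finset.setUidPr; rewrite finset.sub1set.
pose S := [set k in U | adjc p k].
have SU k : k \in S -> k \in U by rewrite inE => /andP[].
have [S' sS' S'0||h hP] := @cocycle_on_coboundary S phi phiC.
- by apply: simp => // k /(fintype.subsetP sS'); rewrite inE => /andP[].
- by move=> i j k /SU Ui /SU Uj /SU Uk; apply: cocU.
have {}hP k l : k \in U -> l \in U -> k != l -> adjc p k -> adjc p l ->
    adjc k l -> phi k l = h k (+) h l.
  by move=> Uk Ul kl pk pl; apply: hP; rewrite ?inE ?Uk ?Ul.
exists (fun i j => if i == p then h j else if j == p then h i else phi i j).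
split=> [i j||i j Ui Uj].
- by case: (eqVneq i p) => [->|_]; case: (eqVneq j p) => [jp|_]; rewrite ?jp ?eqxx.
- move=> i j k; rewrite !inE.
  have [->|ip] /= := eqVneq i p; have [->|jp] /= := eqVneq j p;
    have [->|kp] /= := eqVneq k p; rewrite ?eqxx //= => Ui Uj Uk ij jk ik aij ajk aik.
  + by rewrite (hP j k) // addKb.
  + by apply: hP => //; rewrite adjcC.
  + rewrite (hP i j) // 1?[adjc p _]adjcC //.
    by rewrite -addbA addbb addbF.
  + exact: cocU.
- have ip : i != p by apply: contraNneq pU => <-.
  have jp : j != p by apply: contraNneq pU => <-.
  by rewrite (negPf ip) (negPf jp).
Qed.

Lemma cocycle_on_extend_all U phi : (forall i j, phi i j = phi j i) ->
  (forall p S, (forall k, k \in S -> adjc p k) -> S != finset.set0 ->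
     exists2 i, i \in S & simplicial_in S i) ->
  cocycle_on U phi ->
  exists phi', [/\ forall i j, phi' i j = phi' j i,
      cocycle_on [set: V]%SET phi'
    & forall i j, i \in U -> j \in U -> phi' i j = phi i j].
Proof.
move=> phiC simp cocU.
suff [phi' [phi'C coc' e]] : exists phi', [/\ forall i j, phi' i j = phi' j i,
    cocycle_on (U :|: [set x in enum V]) phi'
  & forall i j, i \in U -> j \in U -> phi' i j = phi i j].
  exists phi'; split=> // i j k _ _ _; apply: coc'; rewrite !inE mem_enum orbT //.
elim: (enum V) => [|p s [psi [psiC cocs e]]].
  exists phi; split=> // i j k Ui Uj Uk.
  by apply: cocU; [move: Ui|move: Uj|move: Uk]; rewrite !inE orbF.
have [psi' [psi'C cocs' e']] := cocycle_on_extend psiC (simp p) cocs.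
exists psi'; split=> // [i j k Ui Uj Uk|i j Ui Uj]; last first.
  by rewrite e' ?e // inE ?Ui ?Uj.
by apply: cocs'; [move: Ui|move: Uj|move: Uk]; rewrite !inE orbCA.
Qed.

End Cocycles.

(** * Mod 2 sums over the triangles of a surface *)

Lemma big_addb_const (I : finType) (P : pred I) b :
  \big[addb/false]_(i | P i) b = odd #|P| && b.
Proof.
rewrite big_const; elim: #|P| => //= n ->.
by case: b; rewrite ?andbF ?andbT.
Qed.

(** A mod 2 Stokes formula: after exchanging the sums each edge is counted as often as its degree,
    twice inside and once on the boundary. *)
Lemma big_addb_boundary N (T : {set {set 'I_N}}) (psi : {set 'I_N} -> bool) :
  (forall e, is_edge T e -> (1 <= edge_degree T e <= 2)%N) ->
  \big[addb/false]_(t in T)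
     \big[addb/false]_(e : {set 'I_N} | (#|e| == 2) && (e \subset t)) psi e =
  \big[addb/false]_(e | is_boundary_edge T e) psi e.
Proof.
move=> degT; rewrite (exchange_big_dep (fun e : {set 'I_N} => #|e| == 2)) /=;
  last by move=> t e _ /andP[].
rewrite big_mkcond [RHS]big_mkcond; apply: eq_bigr => e _.
rewrite /is_boundary_edge /is_edge; case: eqP => //= e2.
rewrite big_addb_const (_ : #|_| = edge_degree T e); last first.
  by apply: eq_card => t; rewrite [RHS]inE.
have [/existsP[t /andP[Tt et]]|no_t] /= := boolP [exists t in T, e \subset t].
  have : is_edge T e.
    by rewrite /is_edge e2; apply/existsP; exists t; rewrite Tt.
  by move=> /degT; case: edge_degree => [|[|[]]].
rewrite (_ : edge_degree T e = 0%N) //; apply/eqP; rewrite cards_eq0.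
apply/set0Pn => -[t]; rewrite inE => /andP[Tt et]; case/existsP: no_t.
by exists t; rewrite Tt.
Qed.

Lemma big_addb_triangle (V : finType) (a b c : V) (psi : {set V} -> bool) :
  a != b -> b != c -> a != c ->
  \big[addb/false]_(e : {set V} | (#|e| == 2) && (e \subset [set a; b; c]%SET))
     psi e
  = psi [set a; b]%SET (+) psi [set b; c]%SET (+) psi [set a; c]%SET.
Proof.
move=> ab bc ac.
have mem_t x : (x \in [set a; b; c]%SET) = [|| x == a, x == b | x == c].
  by rewrite !inE orbA.
rewrite (eq_bigl [in [set a; b] |: ([set b; c] |: [set [set a; c]])]%SET); last first.
  move=> e; rewrite !inE; apply/andP/idP; last first.
    move=> /or3P[] /eqP->; rewrite cards2 ?ab ?bc ?ac; split=> //;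
      by apply/fintype.subsetP => x; rewrite mem_t !inE => /orP[]->; rewrite ?orbT.
  move=> [/cards2P[x [y [xy ->]]] /fintype.subsetP sub].
  have := sub x; rewrite mem_t !inE eqxx => /(_ isT) xt.
  have := sub y; rewrite mem_t !inE eqxx orbT => /(_ isT) yt.
  move: xy; case/or3P: xt => /eqP->; case/or3P: yt => /eqP->;
    rewrite ?eqxx ?orbT // finset.setUC eqxx ?orbT //.
have ne x y z t : x != z -> x != t -> [set x; y]%SET != [set z; t]%SET :> {set V}.
  move=> xz xt; apply/eqP => /setP/(_ x); rewrite !inE eqxx.
  by rewrite (negPf xz) (negPf xt).
have ba : b != a by rewrite eq_sym.
have n1 : [set a; b]%SET != [set b; c]%SET by apply: ne.
have n2 : [set a; b]%SET != [set a; c]%SET by rewrite finset.setUC; apply: ne.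
have n3 : [set b; c]%SET != [set a; c]%SET by apply: ne.
by rewrite !big_setU1 ?big_set1 ?inE ?negb_or ?n1 ?n2 ?n3 //= addbA.
Qed.

Lemma card3_enum (V : finType) (t : {set V}) : #|t| = 3%N ->
  exists a b c, [/\ a != b, b != c, a != c & t = [set a; b; c]%SET].
Proof.
move=> t3; have /card_gt0P[a ta] : (0 < #|t|)%N by rewrite t3.
have /cards2P[b [c [bc tE]]] : #|(t :\ a)%SET| == 2.
  by rewrite -eqSS -t3 (cardsD1 a t) ta.
have : b \in (t :\ a)%SET by rewrite tE !inE eqxx.
have : c \in (t :\ a)%SET by rewrite tE !inE eqxx orbT.
rewrite !inE => /andP[ca _] /andP[ba _].
exists a, b, c; rewrite eq_sym ba bc eq_sym ca; split=> //.
by rewrite -(finset.setD1K ta) tE finset.setUA.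
Qed.

(** * A dome forces a diagonal of finite length *)

Lemma domed_diagonal_finite (R : realType) (O : classical_sets.set R)
    (v : 'I_4 -> 'rV[R]_3) :
  is_valuation_ring O -> can_be_domed v ->
  O (dist2 (v (inord 0)) (v (inord 2))) \/ O (dist2 (v (inord 1)) (v (inord 3))).
Proof.
move=> vO [N [T [f [w [[cardT _ degT _ _] w_inj bdT T_unit fw]]]]].
apply: contrapT => /not_orP[nO02 nO13].
have O1 : O 1 := subring1 vO.1.
pose fin i j := `[< O (dist2 (f i) (f j)) >].
have finC : symmetric fin by move=> i j; rewrite /fin dist2C.
pose W := [set w i | i : 'I_4].
pose phi0 i j := [set i; j]%SET == [set w (inord 0); w (inord 1)]%SET.
have phi0C i j : phi0 i j = phi0 j i by rewrite /phi0 finset.setUC.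
have simp p (S : {set 'I_N}) : (forall k, k \in S -> fin p k) ->
    S != finset.set0 -> exists2 i, i \in S & simplicial_in fin S i.
  move=> pS S0; have [k /pS/asboolP|i Si iP] :=
    @link_simplicial_vertex R O vO _ f (f p) S S0; first by rewrite dist2C.
  exists i => // k l Sk Sl /asboolP ik /asboolP il.
  by apply/asboolP; apply: iP.
have ninf i j : fin (w i) (w j) -> ~~ ((i == inord 0) && (j == inord 2)) &&
    ~~ ((i == inord 1) && (j == inord 3)).
  move=> /asboolP; rewrite !fw => Oij; apply/andP; split; apply/negP.
    by move=> /andP[/eqP ii /eqP jj]; apply: nO02; rewrite -ii -jj.
  by move=> /andP[/eqP ii /eqP jj]; apply: nO13; rewrite -ii -jj.
(* Any three of the four boundary vertices include an opposite pair, which is not adjacent. There is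
   no triangle, and the condition is vacuous. *)
have coc0 : cocycle_on fin W phi0.
  move=> _ _ _ /imsetP[i _ ->] /imsetP[j _ ->] /imsetP[k _ ->].
  rewrite !(inj_eq w_inj) => ij jk ik fij fjk fik; exfalso.
  have fji : fin (w j) (w i) by rewrite finC.
  have fkj : fin (w k) (w j) by rewrite finC.
  have fki : fin (w k) (w i) by rewrite finC.
  move: (ninf _ _ fij) (ninf _ _ fjk) (ninf _ _ fik).
  move: (ninf _ _ fji) (ninf _ _ fkj) (ninf _ _ fki) ij jk ik.
  rewrite -!val_eqE /= !inordK //.
  by case: i {fij fik fji fki} => [[|[|[|[|]]]]] //= _;
    case: j {fjk fkj} => [[|[|[|[|]]]]] //= _; case: k => [[|[|[|[|]]]]].
have [phi [phiC coc phiE]] := cocycle_on_extend_all finC phi0C simp coc0.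
(* The symmetric function [phi] descends to unordered pairs, over which the boundary formula
   sums. *)
pose psi (e : {set 'I_N}) := [exists i, exists j, (e == [set i; j]%SET) && phi i j].
have psiE i j : i != j -> psi [set i; j]%SET = phi i j.
  move=> ij; apply/existsP/idP => [[k /existsP[l /andP[/eqP e kl]]]|ij'].
    have : k \in [set i; j]%SET by rewrite e !inE eqxx.
    have : l \in [set i; j]%SET by rewrite e !inE eqxx orbT.
    have : i \in [set k; l]%SET by rewrite -e !inE eqxx.
    have : j \in [set k; l]%SET by rewrite -e !inE eqxx orbT.
    rewrite !inE => + + /orP[] /eqP li /orP[] /eqP ki; rewrite ?li ?ki ?orbb.
    - by move=> /eqP ji; rewrite ji eqxx in ij.
    - by move=> _ _; rewrite phiC -li -ki.
    - by move=> _ _; rewrite -li -ki.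
    - by move=> _ /eqP ji; rewrite ji eqxx in ij.
  by exists i; apply/existsP; exists j; rewrite eqxx.
have := big_addb_boundary psi degT.
rewrite big1 => [|t Tt]; last first.
  have [a [b [c [ab bc ac tE]]]] := card3_enum (cardT t Tt).
  rewrite tE big_addb_triangle // !psiE //.
  (* The sides of a triangle have squared length 1, which is in [O], so the cocycle condition holds
     on it and its sum is zero. *)
  have tfin x y : x \in t -> y \in t -> x != y -> fin x y.
    move=> tx ty xy; apply/asboolP.
    by rewrite (dist_eq_sqr (T_unit t x y Tt tx ty xy)) expr1n.
  have [ta tb tc] : [/\ a \in t, b \in t & c \in t].
    by rewrite tE !inE !eqxx ?orbT.
  by rewrite (coc a b c) ?tfin ?inE // addbb.
have w01 : is_boundary_edge T [set w (inord 0); w (inord 1)]%SET.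
  apply/bdT; exists (inord 0); congr [set _; w _]%SET.
  by apply/val_inj; rewrite /= !inordK.
have n01 : inord 0 != inord 1 :> 'I_4 by rewrite -val_eqE /= !inordK.
have Ww i : w i \in W by apply: imset_f.
(* On the boundary [phi] agrees with [phi0], so exactly one edge contributes and the total is
   odd. *)
rewrite (bigD1 _ w01) /= psiE ?(inj_eq w_inj) // phiE //.
rewrite [phi0 _ _]eqxx big1 // => e /andP[/bdT[i ->] ne].
rewrite psiE ?phiE //; first exact/negbTE.
rewrite (inj_eq w_inj) -val_eqE /=.
by case: i {ne} => [[|[|[|[|]]]]].
Qed.

Theorem theorem1p1 (R : realType) (v : 'I_4 -> 'rV[R]_3) (a b : R) :
  0 < a -> 0 < b ->
  (forall i : 'I_4, dist (v i) (v (ordS i)) = 1) ->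
  dist (v (inord 0)) (v (inord 2)) = a ->
  dist (v (inord 1)) (v (inord 3)) = b ->
  can_be_domed v ->
  exists P : {poly {poly rat}}, P != 0 /\ eval2 P (a ^+ 2) (b ^+ 2) = 0.
Proof.
move=> a0 b0 vS va vb domed; apply: contrapT => indep.
have [||O [vO nOa nOb]] := exists_valuation_ring_at_infinity _ _ indep.
- by rewrite expf_neq0 // lt0r_neq0.
- by rewrite expf_neq0 // lt0r_neq0.
have := domed_diagonal_finite vO domed.
by rewrite (dist_eq_sqr va) (dist_eq_sqr vb) => -[].
Qed.
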